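(* For every $r\ge1$, let $P_r^{C}=\Phi^+(C_r)$ be the standard positive-root poset of type $C_r$, graded by $\operatorname{rk}=$ root height minus one. Then $$\mathbb{H}_{P_r^{C},\operatorname{rk}}(q,t)=\sum_{w\in\mathcal B_r}q^{\sum_{j\in D(w)}(j-1)}\,t^{|D(w)|}.$$ In particular, this $q$-Zeta numerator is coefficientwise nonnegative for every $r\ge1$.
   Context: $q$-Zeta numerator: let $P$ be a finite graded poset with a unique maximum and rank function $\rho:P\to\{0,\dots,H\}$, where $H$ is the maximal rank. For $m\ge 0$ put $A_m(P,\rho;q)=\sum_{x_1\le\cdots\le x_m}q^{\rho(x_1)+\cdots+\rho(x_m)}$ (sum over weak chains in $P$; $A_0=1$). The numerator $\mathbb{H}_{P,\rho}(q,t)$ is the polynomial determined by $\sum_{m\ge 0}A_m(P,\rho;q)t^m=\mathbb{H}_{P,\rho}(q,t)/\prod_{a=0}^{H}(1-q^at)$. Type $C_r$ in $\mathbb{R}^r$: simple roots $\alpha_i=e_i-e_{i+1}$ ($1\le i<r$), $\alpha_r=2e_r$; positive roots $e_i-e_j$ ($i<j$), $e_i+e_j$ ($i<j$), $2e_i$. Order: $\alpha\le\beta$ iff $\beta-\alpha$ is a nonnegative integer combination of simple roots. Height is the sum of simple-root coefficients. Words: a word in $\{L,R\}$ is a ballot word if every prefix contains at least as many $R$'s as $L$'s. $\mathcal B_r$ is the set of words $w\in\{L,R\}^{2r-2}$ whose reversal is a ballot word (for $r=1$, only the empty word). For $w=w_1\cdots w_m$, $D(w)=\{j: w_j=L\text{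 and }(j=1\text{ or }w_{j-1}=R)\}$. *)

(* Defs.v *)
From HB Require Import structures.
From mathcomp Require Import all_boot all_order all_algebra.
From mathcomp Require Import boolp.

Set Implicit Arguments.
Unset Strict Implicit.
Unset Printing Implicit Defensive.

Import Order.TTheory GRing.Theory Num.Theory.
Local Open Scope ring_scope.

(* Polynomials in q and t are elements of {poly {poly int}}: the outer        *)
(* variable is t, the inner one is q.  Formal power series in t are given by  *)
(* their coefficient sequences nat -> {poly int}.                             *)

Section ZetaNumerator.
Variables (d : Order.disp_t) (P : finPOrderType d) (rho : P -> nat).

Definition chain_poly (m : nat) : {poly int} :=
  \sum_(x : m.-tuple P | sorted <=%O x) 'X^(\sum_(y <- x) rho y)%N.

Definition max_rank : nat := (\max_(x : P) rho x)%N.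

Definition zeta_denom : {poly {poly int}} :=
  \prod_(a < max_rank.+1) (1 - ('X^a)%:P * 'X).

Definition is_zeta_numerator (N : {poly {poly int}}) : Prop :=
  (* N = zeta_denom * (\sum_(m >= 0) chain_poly m t^m), as a Cauchy product *)
  forall n : nat, N`_n = \sum_(k < n.+1) zeta_denom`_k * chain_poly (n - k).

Lemma is_zeta_numerator_unique (N1 N2 : {poly {poly int}}) :
  is_zeta_numerator N1 -> is_zeta_numerator N2 -> N1 = N2.
Proof. by move=> h1 h2; apply/polyP => n; rewrite h1 h2. Qed.

End ZetaNumerator.

(* Coordinates are numbered from 0, so that basis_vec r k is e_(k+1) and      *)
(* simple_root i is alpha_(i+1); all the roots have integer coordinates.      *)

Definition basis_vec (r k : nat) : 'rV[int]_r :=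
  \row_(j < r) (j == k :> nat)%:R.

Definition simple_root (r : nat) (i : 'I_r) : 'rV[int]_r :=
  if i.+1 == r then basis_vec r i *+ 2
  else basis_vec r i - basis_vec r i.+1.

Definition posroots (r : nat) : seq 'rV[int]_r :=
  [seq basis_vec r p.1 - basis_vec r p.2
     | p : 'I_r * 'I_r in [pred p : 'I_r * 'I_r | (p.1 < p.2)%N]]
  ++ [seq basis_vec r p.1 + basis_vec r p.2
     | p : 'I_r * 'I_r in [pred p : 'I_r * 'I_r | (p.1 < p.2)%N]]
  ++ [seq basis_vec r i *+ 2 | i : 'I_r in 'I_r].

Definition simple_comb (r : nat) (c : {ffun 'I_r -> nat}) : 'rV[int]_r :=
  \sum_(i < r) simple_root i *+ c i.

Lemma psum_basis_vec (r : nat) (k : 'I_r) (m : nat) : (m < r)%N ->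
  \sum_(j < r | (j <= k)%N) basis_vec r m 0 j = ((m <= k)%N)%:R.
Proof.
move=> mr; rewrite big_mkcond (bigD1 (Ordinal mr)) //= mxE eqxx big1 ?addr0.
  by case: ifP.
move=> j; rewrite -val_eqE /= => /negPf njm.
by case: ifP => // _; rewrite mxE njm.
Qed.

Lemma psum_simple_root (r : nat) (k i : 'I_r) :
  \sum_(j < r | (j <= k)%N) simple_root i 0 j
    = ((i == k)%:R : int) *+ (if i.+1 == r then 2 else 1).
Proof.
rewrite /simple_root; case: eqP => [ir | /eqP nir].
  under eq_bigr do rewrite mulmxnE.
  rewrite sumrMnl psum_basis_vec //; congr (_%:R *+ _).
  have := ltn_ord k; rewrite -{2}ir ltnS => ki.
  by rewrite -val_eqE /= eqn_leq ki andbT.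
have ir : (i.+1 < r)%N by rewrite ltn_neqAle nir ltn_ord.
under eq_bigr do rewrite mxE [X in _ + X]mxE.
rewrite big_split /= sumrN !psum_basis_vec // -val_eqE /= mulr1n.
by case: ltngtP.
Qed.

Lemma simple_comb_inj (r : nat) : injective (@simple_comb r).
Proof.
have psumE c (k : 'I_r) : \sum_(j < r | (j <= k)%N) simple_comb c 0 j
    = ((c k * (if k.+1 == r then 2 else 1))%N)%:R.
  rewrite /simple_comb; under eq_bigr do rewrite summxE.
  rewrite exchange_big /= (bigD1 k) //= [X in _ + X]big1 ?addr0.
    under eq_bigr do rewrite mulmxnE.
    by rewrite sumrMnl psum_simple_root eqxx -mulrnA mulnC.
  move=> i nik; under eq_bigr do rewrite mulmxnE.
  by rewrite sumrMnl psum_simple_root (negPf nik) !mul0rn.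
move=> c1 c2 eqc; apply/ffunP => k.
have := psumE c1 k; rewrite eqc psumE => /eqP; rewrite eqr_nat => /eqP.
by case: ifP => _; rewrite ?muln1 // => /eqP; rewrite eqn_pmul2r // => /eqP.
Qed.

Lemma simple_combD (r : nat) (c1 c2 : {ffun 'I_r -> nat}) :
  simple_comb c1 + simple_comb c2 = simple_comb [ffun i => (c1 i + c2 i)%N].
Proof.
by rewrite -big_split; apply: eq_bigr => i _; rewrite ffunE mulrnDr.
Qed.

Lemma simple_comb0 (r : nat) : simple_comb [ffun=> 0%N] = 0 :> 'rV[int]_r.
Proof. by apply: big1 => i _; rewrite ffunE. Qed.

Lemma posroot_simple_comb (r : nat) (v : 'rV[int]_r) :
  v \in posroots r -> exists c, v == simple_comb c.
Proof.
pose S v := exists c : {ffun 'I_r -> nat}, v == simple_comb c.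
have SD u w : S u -> S w -> S (u + w).
  by move=> [c /eqP->] [c' /eqP->]; rewrite simple_combD; eexists.
have Ssimple i : S (simple_root i).
  exists [ffun j => (j == i) : nat]; apply/eqP.
  rewrite /simple_comb (bigD1 i) //= ffunE eqxx big1 ?addr0 // => j nji.
  by rewrite ffunE (negPf nji).
have Sdiff i n : (i + n < r)%N -> S (basis_vec r i - basis_vec r (i + n)).
  elim: n => [|n IHn] hn.
    by rewrite addn0 subrr; exists [ffun=> 0%N]; rewrite simple_comb0.
  have hn' : (i + n < r)%N by apply: leq_ltn_trans hn; rewrite leq_add2l.
  have := SD _ _ (IHn hn') (Ssimple (Ordinal hn')).
  rewrite /simple_root /= -addnS ifN ?neq_ltn ?hn //.
  by rewrite addrA subrK.
have Sle i j : (i <= j < r)%N -> S (basis_vec r i - basis_vec r j).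
  by case/andP=> /subnKC <-; apply: Sdiff.
have S2 (i : 'I_r) : S (basis_vec r i + basis_vec r r.-1).
  have r0 : (r.-1 < r)%N by rewrite prednK // (leq_ltn_trans _ (ltn_ord i)).
  have ir : (i <= r.-1 < r)%N.
    by rewrite r0 -ltnS prednK ?ltn_ord // (leq_ltn_trans _ r0).
  have := SD _ _ (Sle _ _ ir) (Ssimple (Ordinal r0)).
  rewrite /simple_root /= prednK ?(leq_ltn_trans _ r0) // eqxx.
  by rewrite mulr2n addrA subrK.
have Sadd (i j : 'I_r) : S (basis_vec r i + basis_vec r j).
  have r0 : (r.-1 < r)%N by rewrite prednK // (leq_ltn_trans _ (ltn_ord i)).
  have jr : (j <= r.-1 < r)%N.
    by rewrite r0 -ltnS prednK ?ltn_ord // (leq_ltn_trans _ r0).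
  have := SD _ _ (S2 i) (Sle _ _ jr).
  by rewrite addrACA subrr addr0.
rewrite !mem_cat => /or3P[] /imageP[].
- by case=> i j /= ij ->; apply: Sle; rewrite ltnW ?ltn_ord.
- by case=> i j /= ij ->; apply: Sadd.
by move=> i _ ->; rewrite mulr2n; apply: Sadd.
Qed.

Definition posrootC (r : nat) : Type := seq_sub (posroots r).
HB.instance Definition _ (r : nat) := Finite.on (posrootC r).

Definition posroot_vec (r : nat) (a : posrootC r) : 'rV[int]_r := ssval a.

Definition root_le (r : nat) (a b : posrootC r) : bool :=
  `[< exists c, posroot_vec b - posroot_vec a = simple_comb c >].

Lemma root_le_refl (r : nat) : reflexive (@root_le r).
Proof.
by move=> a; apply/asboolP; exists [ffun=> 0%N]; rewrite simple_comb0 subrr.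
Qed.

Lemma root_le_anti (r : nat) : antisymmetric (@root_le r).
Proof.
move=> a b /andP[/asboolP[c hc] /asboolP[c' hc']]; apply: val_inj => /=.
suff c0 : c = [ffun=> 0%N].
  apply/esym/subr0_eq.
  by rewrite -[LHS]/(posroot_vec b - posroot_vec a) hc c0 simple_comb0.
have /simple_comb_inj/ffunP h : simple_comb [ffun i => (c i + c' i)%N]
    = simple_comb [ffun=> 0%N] :> 'rV_r.
  by rewrite -simple_combD -hc -hc' simple_comb0 addrA subrK subrr.
by apply/ffunP => i; have /eqP := h i; rewrite !ffunE addn_eq0 => /andP[/eqP].
Qed.

Lemma root_le_trans (r : nat) : transitive (@root_le r).
Proof.
move=> b a e /asboolP[c hc] /asboolP[c' hc']; apply/asboolP.
exists [ffun i => (c' i + c i)%N].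
by rewrite -simple_combD -hc -hc' addrA subrK.
Qed.

Fact root_display : Order.disp_t. Proof. exact: Order.Disp tt tt. Qed.
HB.instance Definition _ (r : nat) := Order.Le_isPOrder.Build root_display
  (posrootC r) (@root_le_refl r) (@root_le_anti r) (@root_le_trans r).

(* The coefficients are unique by simple_comb_inj. *)
Definition simple_coef (r : nat) (a : posrootC r) : {ffun 'I_r -> nat} :=
  xchoose (posroot_simple_comb (ssvalP a)).

Definition height (r : nat) (a : posrootC r) : nat :=
  (\sum_(i < r) simple_coef a i)%N.

Definition root_rank (r : nat) (a : posrootC r) : nat := (height a).-1.

Definition L : bool := false.
Definition R : bool := true.

Definition ballot (w : seq bool) : bool :=
  all (fun k => count_mem L (take k w) <= count_mem R (take k w))%N
      (iota 0 (size w).+1).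

Definition ballot_words (r : nat) : {set (2 * r - 2).-tuple bool} :=
  [set w : (2 * r - 2).-tuple bool | ballot (rev w)].

(* Positions are numbered from 1: the letter w_j is nth _ w j.-1. *)
Definition Dset (w : seq bool) : seq nat :=
  [seq j <- iota 1 (size w)
     | (nth R w j.-1 == L) && ((j == 1%N) || (nth L w j.-2 == R))].

(* Main.v *)
(* In the coordinates (i, j), i < j, i + j < 2r, obtained by unfolding C_r to
   A_(2r-1), the root poset is ordered by inclusion of intervals and the rank is
   j - i - 1.  Let G_(i,j)(t) be the generating series of multichains of intervals
   contained in [i, j).  Inclusion-exclusion on the two lower covers of (i, j) gives
     (1 - q^(j-i-1) t) G_(i,j) = G_(i+1,j) + G_(i,j-1) - G_(i+1,j-1),
   so that N_(i,j) := G_(i,j) \prod_(a < j - i) (1 - q^a t) satisfies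
     N_(i,j) = N_(i+1,j) + N_(i,j-1) - (1 - q^(j-i-2) t) N_(i+1,j-1).
   The weighted sums over ballot words, decomposed by their last two letters,
   obey the same recursion, j - i - 1 being the length of the words and
   2r - 1 - i - j the initial advance of R over L. *)

Require Import Defs.
From mathcomp Require Import all_boot all_order all_algebra.
From mathcomp Require Import boolp zify ring.

Set Implicit Arguments.
Unset Strict Implicit.
Unset Printing Implicit Defensive.

Import Order.TTheory GRing.Theory Num.Theory.
Local Open Scope ring_scope.

(** * Sums over tuples *)

Lemma big_tuple_cons (V : nmodType) (T : finType) (m : nat)
    (Q : pred (seq T)) (F : seq T -> V) :
  \sum_(t : m.+1.-tuple T | Q t) F t
    = \sum_(x : T) \sum_(t : m.-tuple T | Q (x :: t)) F (x :: t).
Proof.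
rewrite (reindex (fun p : T * m.-tuple T => cons_tuple p.1 p.2)) /=; last first.
  exists (fun t => (thead t, behead_tuple t)) => [[x t] _|t _] /=.
    by congr (_, _); apply: val_inj.
  by rewrite [RHS]tuple_eta; apply: val_inj.
by rewrite pair_big_dep /=; apply: eq_bigl.
Qed.

Lemma big_tuple0 (V : nmodType) (T : finType) (Q : pred (seq T))
    (F : seq T -> V) :
  \sum_(t : 0.-tuple T | Q t) F t = if Q [::] then F [::] else 0.
Proof.
rewrite big_mkcond (bigD1 [tuple]) //= big1 ?addr0 // => t.
by rewrite (tuple0 t) => /eqP.
Qed.

Lemma big_tuple_rev (V : nmodType) (T : finType) (m : nat)
    (Q : pred (seq T)) (F : seq T -> V) :
  \sum_(t : m.-tuple T | Q t) F t = \sum_(t : m.-tuple T | Q (rev t)) F (rev t).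
Proof.
rewrite (reindex (fun t : m.-tuple T => [tuple of rev t])) //=.
by exists (fun t : m.-tuple T => [tuple of rev t]) => t _;
  apply: val_inj; rewrite /= revK.
Qed.

(** * Products of a polynomial and a formal power series *)

Definition series_mul (A : nzRingType) (p : {poly A}) (a : nat -> A) (n : nat) : A :=
  \sum_(k < n.+1) p`_k * a (n - k)%N.

(** The [n]-th coefficient of the product sees only finitely many terms of the series, so ring laws
    can be borrowed from polynomials. *)
Lemma series_mul_trunc (A : nzRingType) (p : {poly A}) (a : nat -> A) (n m : nat) :
  (n < m)%N -> series_mul p a n = (p * \poly_(k < m) a k)`_n.
Proof.
move=> nm; rewrite coefM; apply: eq_bigr => k _.
by rewrite coef_poly (leq_ltn_trans (leq_subr _ _) nm).
Qed.

Lemma series_mulA (A : nzRingType) (p1 p2 : {poly A}) (a : nat -> A) :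
  series_mul (p1 * p2) a =1 series_mul p1 (series_mul p2 a).
Proof.
move=> n; rewrite (series_mul_trunc _ _ (ltnSn n)) -mulrA coefM.
by apply: eq_bigr => k _; rewrite (@series_mul_trunc _ _ _ _ n.+1) // ltnS leq_subr.
Qed.

Lemma eq_series_mul (A : nzRingType) (p : {poly A}) (a b : nat -> A) :
  a =1 b -> series_mul p a =1 series_mul p b.
Proof. by move=> eab n; apply: eq_bigr => k _; rewrite eab. Qed.

Lemma series_mul_poly (A : nzRingType) (p1 p2 : {poly A}) :
  series_mul p1 (fun n => p2`_n) =1 (fun n => (p1 * p2)`_n).
Proof. by move=> n; rewrite coefM. Qed.

Lemma series_mul1 (A : nzRingType) (a : nat -> A) : series_mul 1 a =1 a.
Proof.
by move=> n; rewrite (series_mul_trunc _ _ (ltnSn n)) mul1r coef_poly ltnSn.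
Qed.

Lemma series_mulDB (A : nzRingType) (p : {poly A}) (a b c : nat -> A) (n : nat) :
  series_mul p (fun k => a k + b k - c k) n
    = series_mul p a n + series_mul p b n - series_mul p c n.
Proof.
rewrite -sumrN -!big_split; apply: eq_bigr => k _.
by rewrite mulrDr mulrDr mulrN.
Qed.

Lemma series_mul_1subCX (A : nzRingType) (c : A) (a : nat -> A) (n : nat) :
  series_mul (1 - c%:P * 'X) a n = a n - (if n is n'.+1 then c * a n' else 0).
Proof.
rewrite (series_mul_trunc _ _ (ltnSn n)) mulrBl mul1r coefB -mulrA coefCM.
rewrite coefXM !coef_poly ltnSn.
by case: n => [|n] /=; rewrite ?mulr0 // ltnS leqnSn.
Qed.

(** * Weighted sums over ballot words and their recursion *)

(** The head start [s] of [R] over [L] makes the condition stable under removal of the first letter,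
    which only shifts [s]; [ballot] is the case [s = 0]. *)
Definition sballot (s : nat) (u : seq bool) : bool :=
  all (fun k => count_mem L (take k u) <= s + count_mem R (take k u))%N
      (iota 0 (size u).+1).

Lemma sballot_cons (s : nat) (c : bool) (u : seq bool) :
  sballot s (c :: u)
    = all (fun k => (c == L) + count_mem L (take k u)
                      <= s + ((c == R) + count_mem R (take k u)))%N
          (iota 0 (size u).+1).
Proof.
have iotaE n : iota 0 n.+1 = 0%N :: [seq k.+1 | k <- iota 0 n].
  by rewrite -(iotaDl 1 0).
by rewrite /sballot [size (_ :: _)]/= (iotaE (size u).+1) /= all_map.
Qed.

Lemma sballotR (s : nat) (u : seq bool) : sballot s (R :: u) = sballot s.+1 u.
Proof.
rewrite sballot_cons; apply: eq_all => k /=.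
by rewrite add0n addnA addn1.
Qed.

Lemma sballotL (s : nat) (u : seq bool) :
  sballot s (L :: u) = if s is s'.+1 then sballot s' u else false.
Proof. by rewrite sballot_cons; case: s => [|s] //=; rewrite take0. Qed.

(** Membership of [j] depends only on the letters at [j - 1] and [j], so only the new position can
    enter. The default [R] in [last R w] encodes the clause [j = 1]. *)
Lemma Dset_rcons (w : seq bool) (c : bool) :
  Dset (rcons w c)
    = if (c == L) && (last R w == R) then rcons (Dset w) (size w).+1 else Dset w.
Proof.
rewrite /Dset size_rcons -[X in iota 1 X]addn1 iotaD filter_cat add1n /=.
rewrite nth_rcons ltnn eqxx.
have -> : ((size w).+1 == 1%N) || (nth L (rcons w c) (size w).-1 == R)
    = (last R w == R).
  case/lastP: w => [//|w d]; rewrite !size_rcons /= last_rcons.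
  by rewrite nth_rcons size_rcons ltnSn nth_rcons ltnn eqxx.
have -> : [seq j <- iota 1 (size w) | (nth R (rcons w c) j.-1 == L)
      && ((j == 1%N) || (nth L (rcons w c) j.-2 == R))]
    = [seq j <- iota 1 (size w) | (nth R w j.-1 == L)
      && ((j == 1%N) || (nth L w j.-2 == R))].
  apply: eq_in_filter => j; rewrite mem_iota => hj.
  by rewrite !nth_rcons !ifT //; lia.
by case: ifP; rewrite ?cats1 ?cats0.
Qed.

Definition word_weight (w : seq bool) : {poly {poly int}} :=
  ('X^(\sum_(j <- Dset w) j.-1)%N)%:P * 'X^(size (Dset w)).

Lemma word_weight_nil : word_weight [::] = 1.
Proof. by rewrite /word_weight big_nil /= !expr0 mulr1. Qed.

Lemma word_weight_rcons (w : seq bool) (c : bool) :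
  word_weight (rcons w c)
    = word_weight w
      * (if (c == L) && (last R w == R) then ('X^(size w))%:P * 'X else 1).
Proof.
rewrite /word_weight Dset_rcons; case: ifP => _; last by rewrite mulr1.
by rewrite big_rcons /= size_rcons exprD exprSr polyCM; ring.
Qed.

(* [u] is the reversal of the word being weighted. *)
Definition ballot_sum (n s : nat) : {poly {poly int}} :=
  \sum_(u : n.-tuple bool | sballot s u) word_weight (rev u).

Lemma ballot_sum0 (s : nat) : ballot_sum 0 s = 1.
Proof.
by rewrite /ballot_sum (big_tuple0 (sballot s) (word_weight \o rev)) /= word_weight_nil.
Qed.

(** The first letter of [u] is the last letter of the weighted word. An [R] there leaves the weight
    unchanged and raises the head start. *)
Lemma ballot_sumS (n s : nat) :
  ballot_sum n.+1 s = ballot_sum n s.+1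
    + \sum_(u : n.-tuple bool | sballot s (L :: u)) word_weight (rev (L :: u)).
Proof.
rewrite /ballot_sum (big_tuple_cons _ (sballot s) (word_weight \o rev)) big_bool /=.
congr (_ + _); apply: eq_big => u; first by rewrite sballotR.
by rewrite rev_cons word_weight_rcons mulr1.
Qed.

Lemma ballot_sumS0 (n : nat) : ballot_sum n.+1 0 = ballot_sum n 1.
Proof.
by rewrite ballot_sumS [X in _ + X]big_pred0 ?addr0 // => u; rewrite sballotL.
Qed.

Lemma ballot_sum_step (n s : nat) :
  ballot_sum n.+1 s.+1
    = ballot_sum n s + ballot_sum n s.+2
      - (1 - ('X^n)%:P * 'X) * ballot_sum n.-1 s.+1.
Proof.
rewrite ballot_sumS; under eq_bigl do rewrite sballotL.
(* At [n = 0] there is no letter before the final [L]; since [n.-1] is then [0], both sides equal 1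
   + t. *)
case: n => [|n].
  rewrite !ballot_sum0 (big_tuple0 (sballot s) (fun u => word_weight (rev (L :: u)))).
  rewrite /= -[rev _]/(rcons [::] L) word_weight_rcons word_weight_nil expr0 /=.
  by ring.
rewrite [X in _ + X = _](big_tuple_cons _ (sballot s)
  (fun u => word_weight (rev (L :: u)))).
rewrite (ballot_sumS n s) !big_bool /=.
under eq_bigl do rewrite sballotR.
have -> : \sum_(t : n.-tuple bool | sballot s.+1 t) word_weight (rev [:: L, R & t])
    = ('X^(n.+1))%:P * 'X * ballot_sum n s.+1.
  rewrite mulr_sumr; apply: eq_bigr => t _.
  rewrite !rev_cons !word_weight_rcons last_rcons size_rcons size_rev size_tuple /=.
  by rewrite mulr1 mulrC.
have -> : \sum_(t : n.-tuple bool | sballot s (L :: t)) word_weight (rev [:: L, L & t])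
    = \sum_(t : n.-tuple bool | sballot s (L :: t)) word_weight (rev (L :: t)).
  apply: eq_bigr => u _.
  by rewrite [LHS]/word_weight 2!rev_cons Dset_rcons last_rcons.
by ring.
Qed.

(** * Multichains in an abstract trapezoid of intervals *)

Section Trapezoid.
Variables (d : Order.disp_t) (P : finPOrderType d) (rho : P -> nat).
Variables (ci cj : P -> nat) (M : nat).
Hypothesis coord_lt : forall a, (ci a < cj a)%N.
Hypothesis coord_le : forall a, (ci a + cj a <= M)%N.
Hypothesis coord_surj : forall i j, (i < j)%N -> (i + j <= M)%N ->
  exists2 a, ci a = i & cj a = j.
Hypothesis coordE : forall a b : P, (a <= b)%O = (ci b <= ci a)%N && (cj a <= cj b)%N.
Hypothesis rankE : forall a, rho a = (cj a - ci a).-1.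

(** Coefficient of t^m in G_(i,j), with multichains listed downwards from their largest element. The
    box need not correspond to an element of [P]. *)
Fixpoint box_chains (m i j : nat) : {poly int} :=
  if m is m'.+1 then
    \sum_(a : P | (i <= ci a)%N && (cj a <= j)%N)
      'X^(rho a) * box_chains m' (ci a) (cj a)
  else 1.

Lemma box_chains_path (m : nat) (a : P) :
  box_chains m (ci a) (cj a)
    = \sum_(x : m.-tuple P | path >=%O a x) 'X^(\sum_(y <- x) rho y)%N.
Proof.
elim: m a => [|m IHm] a.
  by rewrite (big_tuple0 (path >=%O a) (fun x => 'X^(\sum_(y <- x) rho y)%N)) big_nil.
rewrite (big_tuple_cons _ (path >=%O a) (fun x => 'X^(\sum_(y <- x) rho y)%N)) /=.
rewrite big_mkcond; apply: eq_bigr => b _; rewrite coordE.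
case: ifP => _; last by rewrite big_pred0.
by rewrite IHm mulr_sumr; apply: eq_bigr => x _; rewrite big_cons exprD.
Qed.

(** The element with coordinates [(0, M)] is the maximum, so it bounds every multichain; reversal
    turns increasing lists into decreasing ones. *)
Lemma chain_poly_box (m : nat) : (0 < M)%N ->
  chain_poly rho m = box_chains m 0 M.
Proof.
move=> M0; have [a a0 aM] := coord_surj M0 (leqnn M).
rewrite -a0 -aM box_chains_path /chain_poly.
rewrite (big_tuple_rev _ (sorted <=%O) (fun x => 'X^(\sum_(y <- x) rho y)%N)).
apply: eq_big => x; last by move=> _; rewrite (perm_big _ (permEl (perm_rev x))).
rewrite rev_sorted; case: (tval x) => //= b s; rewrite coordE a0 aM /=.
by rewrite (leq_trans _ (coord_le b)) // leq_addl.
Qed.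

Lemma max_rankE : (0 < M)%N -> max_rank rho = M.-1.
Proof.
move=> M0; have [a a0 aM] := coord_surj M0 (leqnn M).
apply/eqP; rewrite eqn_leq; apply/andP; split.
  apply/bigmax_leqP => b _; rewrite rankE.
  by have := coord_le b; lia.
by have := @leq_bigmax _ rho a; rewrite rankE a0 aM subn0.
Qed.

Lemma box_chains_empty (m i j : nat) : (j <= i)%N -> box_chains m i j = (m == 0)%:R.
Proof.
case: m => // m ji; rewrite /= big1 // => a.
by have := coord_lt a; lia.
Qed.

(** An element gained by the larger box would have right end [j.+1] and left end at least [i],
    violating [coord_le]. *)
Lemma box_chains_out (m i j : nat) : (M < i + j.+1)%N ->
  box_chains m i j.+1 = box_chains m i j.
Proof.
case: m => // m ijM; apply: eq_bigl => a.
by have := coord_le a; lia.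
Qed.

(** The subtracted term on the left collects the multichains whose largest element is [(i, j.+1)].
    Any other largest element lies in one of the two boxes with an end shrunk, and these intersect
    in the last box. *)
Lemma box_chains_step (m i j : nat) : (i <= j)%N -> (i + j < M)%N ->
  box_chains m.+1 i j.+1 - 'X^(j - i) * box_chains m i j.+1
    = box_chains m.+1 i.+1 j.+1 + box_chains m.+1 i j - box_chains m.+1 i.+1 j.
Proof.
move=> ij ijM.
have [||a ai aj] := @coord_surj i j.+1; [by []|by rewrite addnS|].
have eqa b : (b == a) = (ci b == i) && (cj b == j.+1).
  apply/eqP/andP => [->|[/eqP bi /eqP bj]]; first by rewrite ai aj !eqxx.
  by apply/le_anti; rewrite !coordE ai aj bi bj !leqnn.
pose F b := 'X^(rho b) * box_chains m (ci b) (cj b).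
have Fa : F a = 'X^(j - i) * box_chains m i j.+1.
  by rewrite /F rankE ai aj subSn.
(* With [F a] written as a sum over [b == a] and the negative terms moved across, the identity can
   be checked summand by summand. *)
apply/eqP; rewrite -Fa -[F a](big_pred1_eq +%R a F) /= subr_eq addrAC eq_sym subr_eq.
rewrite !(big_mkcond (fun b => _ && _)) (big_mkcond (fun b => b == a)) -!big_split /=.
apply/eqP/eq_bigr => b _; rewrite eqa -/(F b).
have -> : (i <= ci b)%N = (ci b == i) || (i < ci b)%N by lia.
have -> : (cj b <= j.+1)%N = (cj b == j.+1) || (cj b <= j)%N by lia.
have : (ci b == i) && (i < ci b)%N = false by lia.
have : (cj b == j.+1) && (cj b <= j)%N = false by lia.
by do 2![case: eqP => _]; do 2![case: (leqP _ _) => _] => //= _ _;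
  rewrite ?addr0 ?add0r // addrC.
Qed.

(** Strong induction on the length [n], since the recursion reaches back to [n - 1] and [n - 2].
    Here [s] is the distance of the box from the boundary [i + j = M]. *)
Lemma denom_box (n i s : nat) : (i + (i + n) + s = M)%N ->
  series_mul (\prod_(a < n) (1 - ('X^a)%:P * 'X)) (fun m => box_chains m i (i + n))
    =1 (fun m => (ballot_sum n.-1 s)`_m).
Proof.
pose D n : {poly {poly int}} := \prod_(a < n) (1 - ('X^a)%:P * 'X).
have DS l : D l.+1 = D l * (1 - ('X^l)%:P * 'X) by rewrite /D big_ord_recr.
have step l i' j : (j - i' = l)%N -> (i' <= j)%N -> (i' + j < M)%N ->
    series_mul (1 - ('X^l)%:P * 'X) (fun m => box_chains m i' j.+1)
      =1 (fun m => box_chains m i'.+1 j.+1 + box_chains m i' j - box_chains m i'.+1 j).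
  move=> <- ij ijM m; rewrite series_mul_1subCX.
  case: m => [|m]; first by rewrite /=; ring.
  exact: box_chains_step.
rewrite -/(D n); elim/ltn_ind: n i s => -[|[|n]] IHn i s isM m.
- rewrite /D big_ord0 series_mul1 ballot_sum0 coef1.
  by rewrite box_chains_empty // addn0.
- rewrite DS series_mulA [D 0]big_ord0 series_mul1 addn1 step; try lia.
  by rewrite ballot_sum0 coef1 !box_chains_empty //; ring.
rewrite DS series_mulA 2!addnS (eq_series_mul _ (@step _ _ _ _ _ _)); try lia.
case: s isM => [|s] isM.
  (* On the boundary, the box with left end [i.+1] leaves the trapezoid and two of the three terms
     cancel, just as a word without head start cannot begin with [L]. *)
  rewrite ballot_sumS0 -(IHn n.+1 _ i) //; last lia.
  rewrite addnS; apply: eq_series_mul => k.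
  by rewrite (@box_chains_out k i.+1); [ring|lia].
rewrite series_mulDB ballot_sum_step coefB coefD -(IHn n.+1 _ i.+1) //; last lia.
rewrite -(IHn n.+1 _ i) //; last lia.
rewrite -!addnS -[in LHS]addSnnS -addSnnS.
congr (_ + _ - _).
(* The doubly shrunk box has length [n], so [D n] suffices for it; the surplus factor of [D n.+1] is
   the coefficient 1 - q^n t. *)
rewrite -series_mul_poly DS mulrC series_mulA -addSnnS.
by apply: eq_series_mul => k; rewrite (IHn n _ i.+1 s.+1) //; lia.
Qed.

Lemma trapezoid_numerator : (0 < M)%N ->
  is_zeta_numerator rho (ballot_sum M.-1 0).
Proof.
move=> M0 n; have := @denom_box M 0 0 _ n; rewrite /= addn0 => <- //.
rewrite /zeta_denom max_rankE // prednK //.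
by apply: eq_bigr => k _; rewrite chain_poly_box.
Qed.
End Trapezoid.

(** * Interval coordinates on the positive roots of type C *)

(* Type C_r is type A_(2r-1) folded by k |-> 2r-2-k: the positive roots are the
   differences [unfolded r i - unfolded r j] with [i < j] and [i + j < 2r]. *)
Definition unfolded (r k : nat) : 'rV[int]_r :=
  if (k < r)%N then basis_vec r k else - basis_vec r (2 * r - k.+1).

(** Steps [l] and [2 * r - 2 - l] of the unfolded interval both give the simple root [l]. The guard
    keeps the middle step [r - 1], its own mirror image, from counting twice. *)
Definition interval_coef (r i j : nat) : {ffun 'I_r -> nat} :=
  [ffun l : 'I_r => (i <= l < j) + ((l.+1 < r) && (i <= 2 * r - 2 - l < j))]%N.

Lemma interval_coefS (r i j : nat) (l : 'I_r) : (i <= j)%N -> (j.+1 < 2 * r)%N ->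
  interval_coef r i j.+1 l
    = (interval_coef r i j l + (l == minn j (2 * r - 2 - j) :> nat))%N.
Proof. by move=> ij jr; rewrite !ffunE; have := ltn_ord l; lia. Qed.

Lemma interval_coef_nil (r i : nat) : interval_coef r i i = [ffun=> 0%N].
Proof. by apply/ffunP => l; rewrite !ffunE; lia. Qed.

Lemma unfolded_step (r j : nat) (l : 'I_r) : (j.+1 < 2 * r)%N ->
  l = minn j (2 * r - 2 - j) :> nat -> simple_root l = unfolded r j - unfolded r j.+1.
Proof.
move=> jr lE; rewrite /simple_root /unfolded.
(* The long simple root occurs at the middle step [j = r - 1], which passes from a basis vector to
   its opposite. *)
case: eqP => [lr|lr].
  rewrite ifT; last by lia.
  rewrite ifF; last by lia.
  by rewrite opprK mulr2n; congr (basis_vec r _ + basis_vec r _); lia.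
case: (ltnP j.+1 r) => jr1 /=.
  rewrite ifT; last by lia.
  by have -> : nat_of_ord l = j by lia.
rewrite ifF; last by lia.
have -> : (2 * r - j.+1 = l.+1)%N by lia.
have -> : (2 * r - j.+2 = l)%N by lia.
by rewrite opprK addrC.
Qed.

Lemma simple_comb_interval (r i j : nat) : (i <= j)%N -> (j < 2 * r)%N ->
  simple_comb (interval_coef r i j) = unfolded r i - unfolded r j.
Proof.
move=> /subnKC <-; elim: (j - i)%N => [|n IHn] hn.
  by rewrite addn0 interval_coef_nil simple_comb0 subrr.
rewrite addnS in hn *.
have lr : (minn (i + n) (2 * r - 2 - (i + n)) < r)%N by lia.
rewrite -(subrKA (unfolded r (i + n))) -IHn; last by lia.
rewrite -(@unfolded_step _ _ (Ordinal lr)) //.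
have -> : simple_root (Ordinal lr) = simple_comb [ffun l => (l == Ordinal lr) : nat].
  rewrite /simple_comb (bigD1 (Ordinal lr)) //= ffunE eqxx big1 ?addr0 // => l nl.
  by rewrite ffunE (negPf nl).
rewrite simple_combD; congr simple_comb; apply/ffunP => l.
by rewrite interval_coefS ?leq_addr // [RHS]ffunE; congr (_ + _)%N; rewrite ffunE.
Qed.

Lemma sum_interval_coef (r i j : nat) : (i <= j)%N -> (j < 2 * r)%N ->
  (\sum_l interval_coef r i j l = j - i)%N.
Proof.
move=> /subnKC <-; elim: (j - i)%N => [|n IHn] hn.
  by rewrite addn0 subnn interval_coef_nil big1 // => l _; rewrite ffunE.
rewrite addnS in hn *.
have lr : (minn (i + n) (2 * r - 2 - (i + n)) < r)%N by lia.
under eq_bigr do rewrite interval_coefS ?leq_addr //.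
rewrite big_split /= IHn; last by lia.
rewrite (bigD1 (Ordinal lr)) //= eqxx big1 => [|l].
  by rewrite addn0 addn1 subSn // leq_addr.
by rewrite -val_eqE /= => /negPf ->.
Qed.

(** Coefficients over the simple roots are unique, so those of the second interval dominate those of
    the first; suitable indices then detect the two ends. *)
Lemma unfolded_le (r i j i' j' : nat) (c : {ffun 'I_r -> nat}) :
    (i < j)%N -> (i + j < 2 * r)%N -> (i' < j')%N -> (i' + j' < 2 * r)%N ->
  (unfolded r i' - unfolded r j') - (unfolded r i - unfolded r j) = simple_comb c ->
  (i' <= i)%N /\ (j <= j')%N.
Proof.
move=> ij ijr ij' ijr' /eqP; rewrite subr_eq -!simple_comb_interval; try lia.
rewrite simple_combD => /eqP/simple_comb_inj/ffunP eqc.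
have le_coef l : (interval_coef r i j l <= interval_coef r i' j' l)%N.
  by rewrite eqc [leqRHS]ffunE leq_addl.
have bool2 (b1 b2 : bool) : (1 < b1 + b2)%N -> b1 && b2 by case: b1; case: b2.
have ir : (i < r)%N by lia.
(* Positivity at index [i] suffices: if only the mirror step is covered, [i' + j' < 2 * r] still
   bounds [i']. *)
have i'i : (i' <= i)%N.
  have : (0 < interval_coef r i' j' (Ordinal ir))%N.
    by apply: leq_trans (le_coef _); rewrite ffunE /= leqnn ij.
  rewrite ffunE /= addn_gt0 !lt0b => /orP[/andP[]//|/and3P[_ _]].
  by clear -ijr' ij' ir; lia.
split=> //; have [jr|jr] := leqP j r.
  have j1r : (j.-1 < r)%N by lia.
  have : (0 < interval_coef r i' j' (Ordinal j1r))%N.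
    apply: leq_trans (le_coef _); rewrite ffunE /= addn_gt0 lt0b.
    by apply/orP; left; lia.
  rewrite ffunE /= addn_gt0 !lt0b => /orP[/andP[_]|/and3P[_ _]].
    by lia.
  by clear -jr ij; lia.
(* For [j > r], the last step [j.-1] is the mirror of [2 * r - 1 - j], and the interval contains
   both. The coefficient 2 forces the second interval to contain both as well. *)
have j1r : (2 * r - 1 - j < r)%N by lia.
have jE : (2 * r - 2 - (2 * r - 1 - j) = j.-1)%N by lia.
have : (1 < interval_coef r i' j' (Ordinal j1r))%N.
  apply: leq_trans (le_coef _); rewrite ffunE /= jE.
  have -> : (i <= 2 * r - 1 - j < j)%N by lia.
  have -> : ((2 * r - 1 - j).+1 < r)%N && (i <= j.-1 < j)%N by lia.
  by [].
by rewrite ffunE /= jE => /bool2/andP[_ /and3P[_ _]]; lia.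
Qed.

(** With indices from 0, e_i - e_j is sent to [(i, j)] and e_i + e_j, for i at most j, to
    [(i, 2 * r - 1 - j)]; the roots 2e_i are the case i = j. *)
Lemma posroot_coords (r : nat) (v : 'rV[int]_r) : v \in posroots r ->
  exists p : 'I_(2 * r) * 'I_(2 * r),
    [&& (p.1 < p.2)%N, (p.1 + p.2 < 2 * r)%N & v == unfolded r p.1 - unfolded r p.2].
Proof.
have diff (i j : 'I_r) : (i < j)%N -> exists p : 'I_(2 * r) * 'I_(2 * r),
    [&& (p.1 < p.2)%N, (p.1 + p.2 < 2 * r)%N
      & basis_vec r i - basis_vec r j == unfolded r p.1 - unfolded r p.2].
  move=> ij; have := ltn_ord j => jr.
  have i2r : (i < 2 * r)%N by lia.
  have j2r : (j < 2 * r)%N by lia.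
  exists (Ordinal i2r, Ordinal j2r); rewrite /= ij /unfolded !ltn_ord eqxx andbT.
  by lia.
have sum (i j : 'I_r) : (i <= j)%N -> exists p : 'I_(2 * r) * 'I_(2 * r),
    [&& (p.1 < p.2)%N, (p.1 + p.2 < 2 * r)%N
      & basis_vec r i + basis_vec r j == unfolded r p.1 - unfolded r p.2].
  move=> ij; have := ltn_ord j => jr.
  have i2r : (i < 2 * r)%N by lia.
  have j2r : (2 * r - j.+1 < 2 * r)%N by lia.
  exists (Ordinal i2r, Ordinal j2r); rewrite /= /unfolded ltn_ord ifF; last by lia.
  rewrite opprK; apply/and3P; split; try lia.
  by apply/eqP; congr (basis_vec r _ + basis_vec r _); lia.
rewrite !mem_cat => /or3P[] /imageP[].
- by case=> i j /= ij ->; apply: diff.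
- by case=> i j /= ij ->; apply: sum; apply: ltnW.
by move=> i _ ->; rewrite mulr2n; apply: sum.
Qed.

Lemma unfolded_posroot (r i j : nat) : (i < j)%N -> (i + j < 2 * r)%N ->
  unfolded r i - unfolded r j \in posroots r.
Proof.
move=> ij ijr; have ir : (i < r)%N by lia.
rewrite /unfolded ir !mem_cat; case: ltnP => jr.
  by apply/orP; left; apply/imageP; exists (Ordinal ir, Ordinal jr).
have j'r : (2 * r - j.+1 < r)%N by lia.
rewrite opprK; apply/orP; right; apply/orP.
case: (ltnP i (2 * r - j.+1)) => ij'.
  by left; apply/imageP; exists (Ordinal ir, Ordinal j'r).
right; apply/imageP; exists (Ordinal ir) => //=; rewrite mulr2n.
by congr (_ + basis_vec r _); lia.
Qed.

Definition root_coords (r : nat) (a : posrootC r) :=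
  xchoose (posroot_coords (ssvalP a)).
Definition root_left (r : nat) (a : posrootC r) : nat := (root_coords a).1.
Definition root_right (r : nat) (a : posrootC r) : nat := (root_coords a).2.

Lemma root_coordsP (r : nat) (a : posrootC r) :
  [/\ (root_left a < root_right a)%N, (root_left a + root_right a < 2 * r)%N
    & posroot_vec a = unfolded r (root_left a) - unfolded r (root_right a)].
Proof. by case/and3P: (xchooseP (posroot_coords (ssvalP a))) => ? ? /eqP. Qed.

Lemma root_leE (r : nat) (a b : posrootC r) :
  (a <= b)%O = (root_left b <= root_left a)%N && (root_right a <= root_right b)%N.
Proof.
have [ija ijra va] := root_coordsP a; have [ijb ijrb vb] := root_coordsP b.
apply/asboolP/andP => [[c]|[lel ler]].
  by rewrite va vb; apply: unfolded_le.
(* The difference of nested intervals consists of a left and a right remainder, each a nonnegative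
   combination. *)
exists [ffun l => (interval_coef r (root_left b) (root_left a) l
                 + interval_coef r (root_right a) (root_right b) l)%N].
rewrite -simple_combD !simple_comb_interval; try lia.
by rewrite va vb opprB addrACA [RHS]addrACA; congr (_ + _); rewrite addrC.
Qed.

(** The chosen coordinates can only be [(i, j)]: [unfolded_le] applies in both directions to the
    zero difference. *)
Lemma root_coords_surj (r i j : nat) : (i < j)%N -> (i + j < 2 * r)%N ->
  exists2 a : posrootC r, root_left a = i & root_right a = j.
Proof.
move=> ij ijr; pose a : posrootC r := SeqSub (unfolded_posroot ij ijr).
have [ija ijra va] := root_coordsP a.
have ca : simple_comb [ffun=> 0%N] = posroot_vec a - (unfolded r i - unfolded r j).
  by rewrite simple_comb0 subrr.
have ca' : simple_comb [ffun=> 0%N] = unfolded r i - unfolded r j - posroot_vec a.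
  by rewrite simple_comb0 subrr.
rewrite va in ca ca'.
have [l1 r1] := unfolded_le ij ijr ija ijra (esym ca).
have [l2 r2] := unfolded_le ija ijra ij ijr (esym ca').
by exists a; lia.
Qed.

(** By uniqueness the coefficients are those of [interval_coef], whose sum is the length of the
    interval. *)
Lemma root_rankE (r : nat) (a : posrootC r) :
  root_rank a = (root_right a - root_left a).-1.
Proof.
have [ija ijra va] := root_coordsP a.
rewrite /root_rank /height; congr _.-1.
rewrite -(@sum_interval_coef r); try lia.
apply: eq_bigr => l _; congr (fun_of_fin _ l).
apply: simple_comb_inj; rewrite simple_comb_interval -?va; try lia.
by apply/esym/eqP; exact: (xchooseP (posroot_simple_comb (ssvalP a))).
Qed.

(** * Nonnegativity and the numerator of type C *)

Lemma coef_word_weight_ge0 (w : seq bool) (i j : nat) : 0 <= ((word_weight w)`_i)`_j.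
Proof.
rewrite /word_weight coefCM coefXn.
by case: eqP; rewrite ?mulr0 ?coef0 // mulr1 coefXn ler0n.
Qed.

Theorem corollary8p2 (r : nat) (hr : (1 <= r)%N) :
  (forall N : {poly {poly int}},
     is_zeta_numerator (@root_rank r) N <->
     N = \sum_(w in ballot_words r)
           ('X^(\sum_(j <- Dset w) j.-1)%N)%:P * 'X^(size (Dset w)))
  /\ (forall N : {poly {poly int}}, is_zeta_numerator (@root_rank r) N ->
        forall i j : nat, 0 <= (N`_i)`_j).
Proof.
have sumE : ballot_sum (2 * r - 2) 0
    = \sum_(w in ballot_words r)
           ('X^(\sum_(j <- Dset w) j.-1)%N)%:P * 'X^(size (Dset w)).
  rewrite /ballot_sum (big_tuple_rev _ (sballot 0) (word_weight \o rev)).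
  by apply: eq_big => w /=; rewrite ?inE ?revK.
have numer : is_zeta_numerator (@root_rank r) (ballot_sum (2 * r - 2) 0).
  have M0 : (0 < (2 * r).-1)%N by lia.
  have -> : (2 * r - 2)%N = (2 * r).-2 by lia.
  (* The condition [i + j < 2 * r] reads [i + j <= M] for [M = 2 * r - 1], so the words have length
     [M.-1 = 2 * r - 2]. *)
  apply: (@trapezoid_numerator _ _ _ (@root_left r) (@root_right r) (2 * r).-1) => //.
  - by move=> a; case: (root_coordsP a).
  - by move=> a; case: (root_coordsP a); lia.
  - by move=> i j ij ijM; apply: root_coords_surj => //; lia.
  - exact: root_leE.
  - exact: root_rankE.
split=> N; first by rewrite -sumE; split=> [/is_zeta_numerator_unique|->]; first exact.
move=> /is_zeta_numerator_unique/(_ numer) -> i j.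
by rewrite coef_sum coef_sum sumr_ge0 // => u _; apply: coef_word_weight_ge0.
Qed.
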